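(* Let $(V,P)$ be a mixing Markov chain, let $\mu$ be the induced stationary Markov measure on $V^{\mathbb{N}}$, and for $x,y\in V^{\mathbb{N}}$ and $n\ge1$ let $$M_n(x,y)=\inf\{t\ge1: x_t^{t+n-1}=y_t^{t+n-1}\}.$$ Then, with $L(V,P)=-\log\lambda$, $$\lim_{n\to\infty}\frac1n\log M_n(x,y)=L(V,P)\qquad\text{for }\mu\times\mu\text{-almost every }(x,y).$$
   Context: A Markov chain $(V,P)$ consists of a finite set $V$ and a stochastic transition matrix $P$ indexed by $V$; it is mixing if $P^k>0$ entrywise for some $k\ge1$. Let $\pi$ be its unique stationary distribution. Here $\mathbb{N}=\{1,2,\dots\}$ and $x_i^j$ denotes the word $x_i x_{i+1}\cdots x_j$. The measure $\mu$ is the probability measure on $V^{\mathbb{N}}$ characterized by $\mu(\{x:x_1^n=u\})=\pi(u_1)\prod_{j=1}^{n-1}P(u_j,u_{j+1})$ for all $n\ge1$ and $u=u_1\cdots u_n\in V^n$. Let $Q$ be the $|V|\times|V|$ matrix with $Q(u,v)=P(u,v)^2$, let $\lambda$ be its Perron eigenvalue (spectral radius), and $L(V,P)=-\log\lambda$ (natural logarithm). *)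

(* Defs.v *)
From HB Require Import structures.
From mathcomp Require Import all_boot all_order all_algebra.
From mathcomp Require Import complex.
From mathcomp Require Import all_classical all_reals all_analysis.
Import Order.TTheory GRing.Theory Num.Theory.
Import numFieldNormedType.Exports.

Set Implicit Arguments.
Unset Strict Implicit.
Unset Printing Implicit Defensive.

Local Open Scope classical_set_scope.
Local Open Scope ring_scope.

Section markov_chain.
Context {R : realType} {V : finType}.
Implicit Types P : V -> V -> R.

(* The library's matrices are indexed by ordinals, so V is enumerated. *)
Definition matrix_of P : 'M[R]_#|V| :=
  \matrix_(i, j) P (enum_val i) (enum_val j).

Definition stochastic P : Prop :=
  (forall u v, 0 <= P u v) /\ (forall u, \sum_v P u v = 1).

Definition mixing P : Prop :=
  exists2 k : nat, (1 <= k)%N & forall i j, 0 < (matrix_of P ^+ k) i j.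

Definition stationary P (pi : V -> R) : Prop :=
  [/\ forall v, 0 <= pi v, \sum_v pi v = 1
    & forall v, \sum_u pi u * P u v = pi v].

End markov_chain.

(* Largest modulus of a complex eigenvalue. *)
Definition spectral_radius {R : realType} {n : nat} (A : 'M[R]_n) : R :=
  sup [set r | exists2 z : complex R,
    eigenvalue (map_mx (real_complex R) A) z &
    r = complex.ComplexField.Normc.normc z].

Definition chainL {R : realType} {V : finType} (P : V -> V -> R) : R :=
  - ln (spectral_radius (matrix_of (fun u v => P u v ^+ 2))).

(* V^N. A measurableType must be pointed; v0 serves only to provide that point
   (and a default value for nth below). *)
Definition path_space {V : finType} (v0 : V) : Type := nat -> V.

Section words.
Context {V : finType} {v0 : V}.
Implicit Types x : path_space v0.

(* The mathematical indices start at 1, functions on nat at 0. *)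
Definition letter x (j : nat) : V := x j.-1.

(* x_i^j = x_i x_(i+1) ... x_j *)
Definition word x (i j : nat) : seq V :=
  [seq letter x k | k <- iota i (j.+1 - i)].

Definition cylinder (u : seq V) : set (path_space v0) :=
  [set x | word x 1 (size u) = u].

End words.

Section path_space_measurable.
Context {V : finType} (v0 : V).
Notation T := (path_space v0).

HB.instance Definition _ := gen_eqMixin T.
HB.instance Definition _ := gen_choiceMixin T.
HB.instance Definition _ := isPointed.Build T (fun=> v0).

Notation S := (g_sigma_algebraType (range (@cylinder V v0))).

Definition path_display : measure_display := sigma_display (range (@cylinder V v0)).

HB.instance Definition _ := @isMeasurable.Build path_display T
  (measurable : set (set S)) (@measurable0 _ S) (@measurableC _ S)
  (@bigcupT_measurable _ S).

End path_space_measurable.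

Definition markov_measure {R : realType} {V : finType} {v0 : V}
    (P : V -> V -> R) (pi : V -> R) (mu : probability (path_space v0) R) : Prop :=
  forall u : seq V, (1 <= size u)%N ->
    mu (cylinder u) =
      (pi (nth v0 u 0) *
       \prod_(0 <= j < (size u).-1) P (nth v0 u j) (nth v0 u j.+1))%:E.

(* Extended-real valued: the infimum is +oo when x and y never share
   a synchronous word of length n. *)
Definition matching_time (R : realType) {V : finType} {v0 : V} (n : nat)
    (x y : path_space v0) : \bar R :=
  ereal_inf [set (t%:R)%:E | t in [set t : nat |
    (1 <= t)%N /\ word x t (t + n - 1)%N = word y t (t + n - 1)%N]].

(* Main.v *)
Require Import Defs.
From mathcomp Require Import all_boot all_order all_algebra.
From mathcomp Require Import complex ring lra zify.
From mathcomp Require Import all_classical all_reals all_analysis.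
Import Order.TTheory GRing.Theory Num.Theory.
Import numFieldNormedType.Exports.
Set Implicit Arguments.
Unset Strict Implicit.
Unset Printing Implicit Defensive.

Local Open Scope classical_set_scope.
Local Open Scope ring_scope.

(** Write p_n for the probability that two independent stationary copies of the
    chain agree on a given window of length n; it is a sum of entries of Q^(n-1)
    weighted by pi^2, hence of exact order lam^n by the Perron eigenvector of Q.
    Lower bound on M_n: by stationarity and the union bound, a match occurs
    before time lam^(-n) e^(-eps n) with probability O(e^(-eps n)).
    Upper bound on M_n: cut time into blocks of length k + n, where P^k > 0.
    Whatever happened before a block, its last n letters match with probability
    at least c lam^n, so the first m blocks all fail with probability at most
    (1 - c lam^n)^m, which for m = lam^(-n) e^(eps n) is at most
    1 / (c lam^n m) = O(e^(-eps n)).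
    Borel-Cantelli for eps = 1, 1/2, 1/3, ... concludes. *)

(** * Positivity of finite sums and of nonnegative matrix products *)

Lemma fin_pos_lower_bound (R : realType) (T : finType) (t0 : T) (f : T -> R) :
  (forall t, 0 < f t) -> exists2 m, 0 < m & forall t, m <= f t.
Proof.
move=> f0; exists (f [arg min_(t < t0) f t]%O); first exact: f0.
by move=> t; case: arg_minP => // s _; apply.
Qed.

Lemma sumr_gt0_exists (R : realType) (T : finType) (f : T -> R) :
  (forall t, 0 <= f t) -> (exists t, 0 < f t) -> 0 < \sum_t f t.
Proof.
move=> f0 [t ft]; rewrite (bigD1 t)//= ltr_pwDl//.
by apply: sumr_ge0 => s _; exact: f0.
Qed.

Lemma ler_sum_term (R : realType) (T : finType) (f : T -> R) t :
  (forall t, 0 <= f t) -> f t <= \sum_t f t.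
Proof. by move=> f0; rewrite (bigD1 t)//= lerDl sumr_ge0. Qed.

Lemma mulmx_pos (R : realType) n (x : 'rV[R]_n) (A : 'M[R]_n) j :
  (forall i, 0 <= x 0 i) -> x != 0 -> (forall i, 0 < A i j) ->
  0 < (x *m A) 0 j.
Proof.
move=> x0 xn0 A0; rewrite mxE; apply: sumr_gt0_exists => [i|].
  by rewrite mulr_ge0// ltW.
by have /rV0Pn[i xi] := xn0; exists i; rewrite mulr_gt0// lt_def xi x0.
Qed.

Lemma mulmx_ge0 (R : realType) m n p (A : 'M[R]_(m, n)) (B : 'M[R]_(n, p)) :
  (forall i j, 0 <= A i j) -> (forall i j, 0 <= B i j) ->
  forall i j, 0 <= (A *m B) i j.
Proof.
by move=> A0 B0 i j; rewrite mxE sumr_ge0// => k _; rewrite mulr_ge0.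
Qed.

(** * Perron eigenvectors *)

Section perron.
Context (R : realType) (n : nat) (Q : 'M[R]_n).
Hypothesis Q0 : forall i j, 0 <= Q i j.

(* Pairs (x, r) with x in the simplex and r x <= x Q; the Perron pair maximizes
   r. *)
Let S : set ('rV[R]_n * R) := [set p : 'rV[R]_n * R |
  [/\ forall i, 0 <= p.1 0 i, \sum_i p.1 0 i = 1, 0 <= p.2 &
      forall j, p.2 * p.1 0 j <= (p.1 *m Q) 0 j]].

Let simplex_le1 (x : 'rV[R]_n) :
  (forall i, 0 <= x 0 i) -> \sum_i x 0 i = 1 -> forall i, x 0 i <= 1.
Proof.
by move=> x0 <- i; exact: (ler_sum_term (f := x 0)).
Qed.

Let S_bound p : S p -> p.2 <= \sum_j \sum_i Q i j.
Proof.
case=> x0 x1 r0 xQ; rewrite -[p.2]mulr1 -x1 mulr_sumr; apply: ler_sum => j _.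
apply: le_trans (xQ j) _; rewrite mxE; apply: ler_sum => i _.
by rewrite ler_piMl// simplex_le1.
Qed.

(** [S] is a closed subset of the unit cube times [[0, M]], where the bound [M] on [r] comes from
    summing [r x <= x Q] over the coordinates. *)
Let S_compact : compact S.
Proof.
pose M := \sum_j \sum_i Q i j.
pose B := [set x : 'rV[R]_n | forall i, `[0, 1]%classic (x ord0 i)].
have cB : compact B.
  apply: (@rV_compact R n (fun=> `[0, 1]%classic)) => i.
  exact: segment_compact.
apply: (@subclosed_compact _ _ (B `*` `[0, M]%classic)).
- have cp1 (i : 'I_n) : continuous (fun p : 'rV[R]_n * R => p.1 0 i).
    move=> p; apply: (@continuous_comp _ _ _ (@fst ('rV[R]_n) R)
      (fun x : 'rV[R]_n => x 0 i)).
      exact: cvg_fst.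
    exact: coord_continuous.
  have -> : S = (\bigcap_i [set p : 'rV[R]_n * R | 0 <= p.1 0 i]) `&`
     [set p : 'rV[R]_n * R | \sum_i p.1 0 i = 1] `&`
     [set p : 'rV[R]_n * R | 0 <= p.2] `&`
     (\bigcap_j [set p : 'rV[R]_n * R |
        0 <= \sum_i p.1 0 i * Q i j - p.2 * p.1 0 j]).
    apply/seteqP; split=> p /=.
      case=> x0 x1 r0 xQ; split; [split; [split|]|] => // i _ /=.
        exact: x0.
      by rewrite subr_ge0; have := xQ i; rewrite mxE.
    case=> [[[x0 x1] r0] xQ]; split => // j; first exact: x0.
    by have := xQ j I; rewrite /= subr_ge0 mxE.
  apply: closedI; [apply: closedI; [apply: closedI|]|].
  + apply: closed_bigI => i _.
    apply: (@preimage_closed _ _ (fun p : 'rV[R]_n * R => p.1 0 i)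
      [set x | 0 <= x]); last exact: closed_ge.
    by move=> p _; exact: cp1.
  + apply: (@preimage_closed _ _ (fun p : 'rV[R]_n * R => \sum_i p.1 0 i)
      [set x | x = 1]); last exact: closed_eq.
    move=> p _; apply: cvg_big => [|i _]; first exact: add_continuous.
    exact: cp1.
  + apply: (@preimage_closed _ _ (fun p : 'rV[R]_n * R => p.2)
      [set x | 0 <= x]); last exact: closed_ge.
    by move=> p _; exact: cvg_snd.
  + apply: closed_bigI => j _.
    apply: (@preimage_closed _ _ (fun p : 'rV[R]_n * R =>
        \sum_i p.1 0 i * Q i j - p.2 * p.1 0 j)
      [set x | 0 <= x]); last exact: closed_ge.
    move=> p _; apply: cvgB.
      apply: cvg_big => [|i _]; first exact: add_continuous.
      apply: cvgM; [exact: cp1|exact: cvg_cst].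
    by apply: cvgM; [exact: cvg_snd|exact: cp1].
- by apply: compact_setX => //; exact: segment_compact.
- move=> p Sp; have [x0 x1 r0 xQ] := Sp; split => /=.
    by move=> i /=; rewrite in_itv/= x0 simplex_le1.
  by rewrite in_itv/= r0; exact: S_bound.
Qed.

(** The Collatz-Wielandt argument: compactness of [S] yields a pair with maximal [r], and positivity
    of [Q ^+ k] turns it into an eigenpair. *)
Lemma perron_left k : (0 < n)%N -> (0 < k)%N ->
  (forall i j, 0 < (Q ^+ k) i j) ->
  exists (lam : R) (l : 'rV[R]_n), [/\ 0 < lam, forall i, 0 < l 0 i,
    \sum_i l 0 i = 1 & l *m Q = lam *: l].
Proof.
move=> n0 k0 Qk0; pose i0 := Ordinal n0.
have S0 : S !=set0.
  exists (delta_mx 0 i0, 0); split => //=.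
  - by move=> i; rewrite mxE eqxx/=; case: eqP.
  - rewrite (bigD1 i0)//= mxE !eqxx big1 ?addr0// => i /negbTE i0'.
    by rewrite mxE i0' andbF.
  - move=> j; rewrite mul0r; apply: mulmx_ge0 => // a b.
    by rewrite mxE ler0n.
have [|[x r] Sxr rmax] :=
    @compact_EVT_max _ R (fun p : 'rV[R]_n * R => p.2) S S0 S_compact.
  by apply: continuous_subspaceT => p; exact: cvg_snd.
move: Sxr; rewrite inE => -[/= x0 x1 r0 xQ].
have xn0 : x != 0.
  apply/eqP => xz; move: x1; rewrite big1 => [/eqP|i _]; last by rewrite xz mxE.
  by rewrite eq_sym oner_eq0.
have eigx : x *m Q = r *: x.
  (* Otherwise y = x Q^k satisfies r y < y Q entrywise, so r is not maximal. *)
  apply/eqP; rewrite -subr_eq0; apply/negPn/negP => dn0.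
  pose d := x *m Q - r *: x.
  have d0 i : 0 <= d 0 i by have := xQ i; rewrite !mxE subr_ge0.
  pose y := x *m Q ^+ k.
  have y0 j : 0 < y 0 j by exact: mulmx_pos.
  have dQ0 j : 0 < (d *m Q ^+ k) 0 j by exact: mulmx_pos.
  have [m m0 md] := @fin_pos_lower_bound R 'I_n i0 _ dQ0.
  pose Y := \sum_j y 0 j.
  have Y0 : 0 < Y.
    by apply: sumr_gt0_exists => [j|]; [rewrite ltW|exists i0].
  have yQ : y *m Q = r *: y + d *m Q ^+ k.
    rewrite /d mulmxBl -scalemxAl addrC subrK /y -!mulmxA.
    by congr (_ *m _); exact: etrans (esym (exprSr Q k)) (exprS Q k).
  have yY j : y 0 j <= Y.
    by rewrite /Y (bigD1 j)//= lerDl sumr_ge0// => i _; rewrite ltW.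
  (* Normalizing [y] brings it back to the simplex. Every coordinate of [y] is at most [Y], so the
     surplus, which is at least [m], pays for raising [r] by [m / Y]. *)
  have : (Y^-1 *: y, r + m / Y) \in S.
    rewrite inE; split => /=.
    - by move=> i; rewrite mxE mulr_ge0// ?invr_ge0 ltW.
    - under eq_bigr do rewrite mxE.
      by rewrite -mulr_sumr mulVf// gt_eqF.
    - by rewrite addr_ge0// divr_ge0// ltW.
    - move=> j; rewrite -scalemxAl yQ.
      move: (d *m Q ^+ k) md => D md; rewrite !mxE mulrCA ler_pM2l ?invr_gt0//.
      rewrite mulrDl lerD2l; apply: le_trans (md j).
      rewrite -mulrA ger_pMr// ler_pdivrMl// mulr1.
      by have := yY j; rewrite mxE.
  move=> /rmax /=; rewrite gerDl leNgt divr_gt0//.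
have eigk : x *m Q ^+ k = r ^+ k *: x.
  elim: (k) => [|k' IH]; first by rewrite !expr0 mulmx1 scale1r.
  have -> : Q ^+ k'.+1 = Q ^+ k' *m Q by exact: exprSr.
  by rewrite mulmxA IH -scalemxAl eigx scalerA exprSr.
(* [x Q^k] is positive everywhere and equals [r^k x], which excludes [r = 0] and zero coordinates of
   [x]. *)
have rx j : 0 < r ^+ k * x 0 j.
  by have := @mulmx_pos R n x (Q ^+ k) j x0 xn0 (Qk0^~ j); rewrite eigk mxE.
exists r, x; split=> //.
- rewrite lt_def r0 andbT; apply: contraTneq (rx i0) => ->.
  by rewrite expr0n -[k == 0%N]negbK -lt0n k0 mul0r ltxx.
- by move=> i; rewrite lt_def x0 andbT; apply: contraTneq (rx i) => ->;
    rewrite mulr0 ltxx.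
Qed.

End perron.

Lemma trmx_exp (R : comNzRingType) n (A : 'M[R]_n) k : (A ^+ k)^T = A^T ^+ k.
Proof.
elim: k => [|k IH]; first by rewrite !expr0; exact: trmx1.
have -> : A ^+ k.+1 = A *m A ^+ k by exact: exprS.
by rewrite trmx_mul IH; exact: esym (exprSr _ _).
Qed.

(** Applying [perron_left] to the transpose gives a positive right eigenvector [h]. For a complex
    eigenpair [(z, w)] the triangle inequality gives [|z| |w| <= |w| Q] entrywise, and pairing with
    [h] gives [|z| <= lam]; the supremum is attained at [lam]. *)
Lemma spectral_radius_perron (R : realType) n (Q : 'M[R]_n) k :
  (forall i j, 0 <= Q i j) -> (0 < n)%N -> (0 < k)%N ->
  (forall i j, 0 < (Q ^+ k) i j) ->
  exists (lam : R) (l : 'rV[R]_n), [/\ 0 < lam, forall i, 0 < l 0 i,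
    \sum_i l 0 i = 1, l *m Q = lam *: l & spectral_radius Q = lam].
Proof.
move=> Q0 n0 k0 Qk0.
have [lam [l [lam0 l0 l1 lQ]]] := perron_left Q0 n0 k0 Qk0.
have [|| lam' [h [_ h0 _ hQ]]] := @perron_left R n Q^T _ k n0 k0.
- by move=> i j; rewrite mxE.
- by move=> i j; rewrite -trmx_exp mxE.
have Qh : Q *m h^T = lam' *: h^T.
  by rewrite -[Q]trmxK -trmx_mul hQ linearZ.
have sum_lh : 0 < \sum_i l 0 i * h 0 i.
  apply: sumr_gt0_exists => [i|]; first by rewrite mulr_ge0// ltW.
  by exists (Ordinal n0); rewrite mulr_gt0.
(* Evaluating [l Q h] from the left and from the right gives the same number, and [l h] is
   positive. *)
have lamE : lam' = lam.
  have : lam *: (l *m h^T) = lam' *: (l *m h^T).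
    by rewrite scalemxAl -lQ -mulmxA Qh -scalemxAr.
  move=> /matrixP/(_ 0 0); rewrite !mxE.
  under eq_bigr do rewrite mxE.
  by move=> /mulIf ->//; rewrite gt_eqF.
have bound (z : complex R) : eigenvalue (map_mx (real_complex R) Q) z ->
    complex.ComplexField.Normc.normc z <= lam.
  move=> /eigenvalueP[w wQ wn0].
  pose m i := complex.ComplexField.Normc.normc (w 0 i).
  have mE i : (m i)%:C%C = `|w 0 i| by [].
  have m0 i : 0 <= m i by rewrite -lecR mE normr_ge0.
  have wQle j : complex.ComplexField.Normc.normc z * m j <=
      \sum_i m i * Q i j.
    rewrite -lecR rmorphM/= -/(`|z|) mE -normrM.
    have -> : z * w 0 j = \sum_i w 0 i * (Q i j)%:C%C.
      have /rowP/(_ j) := wQ; rewrite !mxE => <-.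
      by apply: eq_bigr => i _; rewrite mxE.
    apply: le_trans (ler_norm_sum _ _ _) _.
    rewrite rmorph_sum; apply: ler_sum => i _.
    by rewrite normrM rmorphM/= mE ler_wpM2l// ger0_norm// lecR.
  have mh0 : 0 < \sum_i m i * h 0 i.
    apply: sumr_gt0_exists => [i|]; first by rewrite mulr_ge0// ltW.
    have /rV0Pn[i wi] := wn0.
    by exists i; rewrite mulr_gt0// -ltcR mE normr_gt0.
  rewrite -(ler_pM2r mh0) mulr_sumr.
  apply: (@le_trans _ _ (\sum_j (\sum_i m i * Q i j) * h 0 j)).
    by apply: ler_sum => j _; rewrite mulrA ler_wpM2r// ltW.
  under eq_bigr do rewrite mulr_suml.
  rewrite exchange_big/= mulr_sumr; apply: ler_sum => i _.
  have := Qh => /matrixP/(_ i 0); rewrite !mxE lamE => e.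
  rewrite [leRHS]mulrCA -e mulr_sumr le_eqVlt; apply/orP; left; apply/eqP.
  by apply: eq_bigr => j _; rewrite mxE mulrA.
exists lam, l; split=> //; apply/eqP; rewrite eq_le; apply/andP.
have lam_in : [set r | exists2 z : complex R,
    eigenvalue (map_mx (real_complex R) Q) z &
    r = complex.ComplexField.Normc.normc z] lam.
  exists lam%:C%C.
    rewrite eigenvalue_map; apply/eigenvalueP; exists l => //.
    apply/eqP => lz; move: (l0 (Ordinal n0)); rewrite lz mxE ltxx//.
  by rewrite /= expr0n addr0 sqrtr_sqr ger0_norm// ltW.
split.
  by apply: ge_sup; [exists lam|move=> _ [z /bound zl ->]].
by apply: ub_le_sup => //; exists lam => _ [z /bound zl ->].
Qed.

(** * Finite-horizon expectations of Markov chains *)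

Section path_expectation.
Context {R : realType} {W : finType}.
Variable K : W -> W -> R.
Implicit Types (f g : seq W -> R) (a : W).

(* Expected value of f on the next n letters of the chain K, started at a. *)
Fixpoint path_exp n f a : R :=
  if n is n'.+1 then \sum_b K a b * path_exp n' (fun s => f (b :: s)) b
  else f [::].

Lemma eq_path_exp n f g a :
  (forall s, size s = n -> f s = g s) -> path_exp n f a = path_exp n g a.
Proof.
elim: n f g a => [|n IH] f g a fg /=; first exact: fg.
by apply: eq_bigr => b _; congr (_ * _); apply: IH => s sn; rewrite fg//= sn.
Qed.

Lemma path_expZ n c f a : path_exp n (fun s => c * f s) a = c * path_exp n f a.
Proof.
elim: n f a => [//|n IH] f a /=; rewrite mulr_sumr.
by apply: eq_bigr => b _; rewrite IH mulrCA.
Qed.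

Lemma path_exp_sum n (I : finType) (F : I -> seq W -> R) a :
  path_exp n (fun s => \sum_i F i s) a = \sum_i path_exp n (F i) a.
Proof.
elim: n F a => [//|n IH] F a /=; rewrite exchange_big/=.
by apply: eq_bigr => b _; rewrite IH mulr_sumr.
Qed.

(** The Markov property at time [n]: given the first [n] letters, the rest is a fresh chain started
    at the last of them. *)
Lemma path_exp_split n m f g a :
  path_exp (n + m) (fun s => f (take n s) * g (drop n s)) a =
  path_exp n (fun s => f s * path_exp m g (last a s)) a.
Proof.
elim: n f a => [|n IH] f a.
  rewrite add0n [RHS]/= -path_expZ; apply: eq_path_exp => s _.
  by rewrite take0 drop0.
by rewrite addSn /=; apply: eq_bigr => b _; rewrite -IH.
Qed.

Hypothesis K0 : forall a b, 0 <= K a b.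

Lemma le_path_exp n f g a : (forall s, size s = n -> f s <= g s) ->
  path_exp n f a <= path_exp n g a.
Proof.
elim: n f g a => [|n IH] f g a fg /=; first exact: fg.
apply: ler_sum => b _; rewrite ler_wpM2l//.
by apply: IH => s sn; rewrite fg//= sn.
Qed.

Lemma path_exp_ge0 n f a : (forall s, 0 <= f s) -> 0 <= path_exp n f a.
Proof.
elim: n f a => [|n IH] f a f0 /=; first exact: f0.
by apply: sumr_ge0 => b _; rewrite mulr_ge0// IH.
Qed.

Hypothesis K1 : forall a, \sum_b K a b = 1.

Lemma path_exp_compl n f a :
  path_exp n (fun s => 1 - f s) a = 1 - path_exp n f a.
Proof.
elim: n f a => [//|n IH] f a /=.
under eq_bigr do rewrite IH mulrBr mulr1.
by rewrite sumrB K1.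
Qed.

(** By induction on [t]: one step of the chain leaves [p] invariant, so the first letter can be
    averaged away. *)
Lemma path_exp_stationary (p : W -> R) n t f :
  (forall b, \sum_a p a * K a b = p b) ->
  \sum_a p a * path_exp (t + n) (fun s => f (drop t (a :: s))) a =
  \sum_a p a * path_exp n (fun s => f (a :: s)) a.
Proof.
move=> pK; elim: t => [//|t IH]; rewrite -IH.
under eq_bigr do rewrite addSn /= mulr_sumr.
rewrite exchange_big/=; apply: eq_bigr => b _.
by under eq_bigr do rewrite mulrA; rewrite -mulr_suml pK.
Qed.

End path_expectation.

(** * The chain of two independent copies and its visits to the diagonal *)

Section pair_chain.
Context {R : realType} {V : finType}.
Implicit Types (P : V -> V -> R) (a b : V * V).

Definition pair_kernel P a b : R := P a.1 b.1 * P a.2 b.2.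

Definition diag a : bool := a.1 == a.2.

Lemma sum_pair (F : V * V -> R) : \sum_a F a = \sum_u \sum_v F (u, v).
Proof. by rewrite pair_big/=; apply: eq_bigr => -[]. Qed.

Lemma sum_diag (F : V * V -> R) : \sum_a (diag a)%:R * F a = \sum_v F (v, v).
Proof.
rewrite sum_pair; apply: eq_bigr => u _.
rewrite (bigD1 u)//= /diag eqxx mul1r big1 ?addr0// => v.
by rewrite eq_sym => /negbTE -> /=; rewrite mul0r.
Qed.

(** Independence of the two coordinates: the kernel is a product, so the expectation factors step by
    step. *)
Lemma path_exp_pair P n (f g : seq V -> R) a :
  path_exp (pair_kernel P) n
    (fun s => f (map fst s) * g (map snd s)) a =
  path_exp P n f a.1 * path_exp P n g a.2.
Proof.
elim: n f g a => [//|n IH] f g a /=; rewrite sum_pair mulr_suml.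
apply: eq_bigr => u _; rewrite mulr_sumr; apply: eq_bigr => v _ /=.
rewrite (IH (fun s => f (u :: s)) (fun s => g (v :: s)))/=.
by rewrite /pair_kernel/= mulrACA.
Qed.

Lemma sum_enum_rank (F : 'I_#|V| -> R) : \sum_i F i = \sum_v F (enum_rank v).
Proof.
by rewrite (reindex enum_rank)//; apply: onW_bij; exact: enum_rank_bij.
Qed.

Lemma path_exp_last P n u v :
  path_exp P n (fun s => (last u s == v)%:R) u =
  (matrix_of P ^+ n) (enum_rank u) (enum_rank v).
Proof.
elim: n u => [|n IH] u /=.
  by rewrite expr0 mxE (inj_eq enum_rank_inj).
rewrite exprS mxE sum_enum_rank; apply: eq_bigr => w _.
by rewrite IH mxE !enum_rankK.
Qed.

(** The starting pair is not tested. From [(v, v)] this is the row sum of Q^n at [v], with Q the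
    matrix of squared transition probabilities. *)
Definition diag_prob P n a : R :=
  path_exp (pair_kernel P) n (fun s => (all diag s)%:R) a.

Lemma diag_probS P n v :
  diag_prob P n.+1 (v, v) = \sum_w P v w ^+ 2 * diag_prob P n (w, w).
Proof.
rewrite -[RHS](sum_diag (fun b => pair_kernel P (v, v) b * diag_prob P n b)).
apply: eq_bigr => b _; rewrite mulrCA; congr (_ * _).
rewrite -path_expZ; apply: eq_path_exp => s _ /=.
by rewrite -natrM mulnb.
Qed.

(** The sum is [l Q^n 1], and [l] is a left eigenvector of total mass 1. Other weights are later
    compared with [l]. *)
Lemma sum_diag_prob P (l : V -> R) lam n :
  \sum_v l v = 1 -> (forall w, \sum_v l v * P v w ^+ 2 = lam * l w) ->
  \sum_v l v * diag_prob P n (v, v) = lam ^+ n.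
Proof.
move=> l1 lP; elim: n => [|n IH].
  by rewrite expr0 -l1; apply: eq_bigr => v _; rewrite mulr1.
under eq_bigr do rewrite diag_probS mulr_sumr.
rewrite exchange_big/= exprS -IH mulr_sumr; apply: eq_bigr => w _.
under eq_bigr do rewrite mulrA.
by rewrite -mulr_suml lP mulrA.
Qed.

Section blocks.
Variable P : V -> V -> R.
Hypothesis Pstoch : stochastic P.

Lemma pair_kernel_ge0 a b : 0 <= pair_kernel P a b.
Proof. by case: Pstoch => P0 _; rewrite mulr_ge0. Qed.

Lemma pair_kernel_sum a : \sum_b pair_kernel P a b = 1.
Proof.
case: Pstoch => _ P1; rewrite sum_pair -(P1 a.1).
apply: eq_bigr => u _; rewrite -[RHS]mulr1 -(P1 a.2) mulr_sumr.
exact: eq_bigr.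
Qed.

Lemma diag_prob_ge0 n a : 0 <= diag_prob P n a.
Proof. by apply: path_exp_ge0 => //; exact: pair_kernel_ge0. Qed.

(** After [k.+1] steps both copies are at a given [v] with probability at least [delta ^+ 2],
    whatever the start; from [(v, v)] they then stay together for [n] more steps with probability
    [diag_prob P n (v, v)]. *)
Lemma block_match_prob k n delta a :
  (forall u v, delta <= (matrix_of P ^+ k.+1) u v) -> 0 <= delta ->
  delta ^+ 2 * \sum_v diag_prob P n (v, v) <=
  path_exp (pair_kernel P) (k.+1 + n) (fun s => (all diag (drop k s))%:R) a.
Proof.
move=> Pk delta0.
(* The first diagonal letter is the last one of the initial k.+1. *)
have -> : path_exp (pair_kernel P) (k.+1 + n)
      (fun s => (all diag (drop k s))%:R) a =
    path_exp (pair_kernel P) (k.+1 + n) (fun s =>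
      (diag (last a (take k.+1 s)))%:R * (all diag (drop k.+1 s))%:R) a.
  apply: eq_path_exp => s sn.
  have ks : (k < size s)%N by rewrite sn addSn ltnS leq_addr.
  rewrite (drop_nth a ks) (take_nth a ks) last_rcons/=.
  by case: (diag _); rewrite ?mul1r ?mul0r.
rewrite (path_exp_split _ k.+1 n (fun s => (diag (last a s))%:R)
  (fun s => (all diag s)%:R)).
(* Split according to the common letter [v] at which the copies meet. *)
have -> : path_exp (pair_kernel P) k.+1 (fun s => (diag (last a s))%:R *
      path_exp (pair_kernel P) n (fun s => (all diag s)%:R) (last a s)) a =
    \sum_v diag_prob P n (v, v) *
      path_exp (pair_kernel P) k.+1 (fun s => (last a s == (v, v))%:R) a.
  under [RHS]eq_bigr do rewrite -path_expZ.
  rewrite -path_exp_sum; apply: eq_path_exp => s _.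
  rewrite -(sum_diag (fun b => diag_prob P n b * (last a s == b)%:R)).
  rewrite (bigD1 (last a s))//= eqxx mulr1 big1 ?addr0// => b.
  by rewrite eq_sym => /negbTE ->; rewrite !mulr0.
rewrite mulr_sumr; apply: ler_sum => v _; rewrite mulrC.
apply: ler_wpM2l; first exact: diag_prob_ge0.
have -> : path_exp (pair_kernel P) k.+1 (fun s => (last a s == (v, v))%:R) a =
    path_exp (pair_kernel P) k.+1 (fun s =>
      (last a.1 (map fst s) == v)%:R * (last a.2 (map snd s) == v)%:R) a.
  apply: eq_path_exp => s _; rewrite !last_map.
  by case: (last a s) => x y /=; rewrite xpair_eqE -natrM mulnb.
rewrite (path_exp_pair P k.+1 (fun s => (last a.1 s == v)%:R)
  (fun s => (last a.2 s == v)%:R)) !path_exp_last.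
by rewrite expr2 ler_pM.
Qed.

(** Blocks have length [B]. The first [k] letters of each are a gap in which the past is forgotten,
    and only the remainder is tested; matches across blocks do not count. *)
Fixpoint no_match k B m (s : seq (V * V)) : bool :=
  if m is m'.+1 then
    ~~ all diag (drop k (take B s)) && no_match k B m' (drop B s)
  else true.

(** By the Markov property at the end of the first block: a block fails with probability at most
    [1 - q] from every starting pair, so the bounds multiply. *)
Lemma no_match_prob k B q m a : q <= 1 ->
  (forall a, q <= path_exp (pair_kernel P) B
     (fun s => (all diag (drop k s))%:R) a) ->
  path_exp (pair_kernel P) (m * B) (fun s => (no_match k B m s)%:R) a
    <= (1 - q) ^+ m.
Proof.
move=> q1 hq; elim: m a => [a|m IH a]; first by rewrite mul0n expr0.
have -> : path_exp (pair_kernel P) (m.+1 * B)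
      (fun s => (no_match k B m.+1 s)%:R) a =
    path_exp (pair_kernel P) (B + m * B) (fun s =>
      (~~ all diag (drop k (take B s)))%:R * (no_match k B m (drop B s))%:R) a.
  by rewrite mulSn; apply: eq_path_exp => s _; rewrite -natrM mulnb.
rewrite (path_exp_split _ _ _ (fun s => (~~ all diag (drop k s))%:R)
  (fun s => (no_match k B m s)%:R)).
apply: (@le_trans _ _ (path_exp (pair_kernel P) B (fun s =>
   (1 - q) ^+ m * (~~ all diag (drop k s))%:R) a)).
  apply: le_path_exp => [|s _]; first exact: pair_kernel_ge0.
  by rewrite mulrC ler_wpM2r.
rewrite path_expZ exprSr ler_wpM2l ?exprn_ge0 ?subr_ge0//.
have -> : path_exp (pair_kernel P) B (fun s => (~~ all diag (drop k s))%:R) a =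
    path_exp (pair_kernel P) B (fun s => 1 - (all diag (drop k s))%:R) a.
  by apply: eq_path_exp => s _; case: all; rewrite ?subrr ?subr0.
by rewrite path_exp_compl ?lerB//; exact: pair_kernel_sum.
Qed.

(** A block of length [k.+1 + n] without its first [k] letters has exactly [n.+1] letters, so a
    successful block contains a match of that length. *)
Lemma no_matchPn k n m s : size s = (m * (k.+1 + n))%N ->
  ~~ no_match k (k.+1 + n) m s ->
  exists2 t, (t + n.+1 <= size s)%N & all diag (take n.+1 (drop t s)).
Proof.
elim: m s => [//|m IH] s ss; rewrite negb_and negbK => /orP[h|].
  exists k.
    by rewrite ss mulSn addnS addSn leq_addr.
  by rewrite take_drop addSnnS addnC.
move=> /IH[|t ht h]; first by rewrite size_drop ss mulSn addKn.
exists (k.+1 + n + t)%N.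
  rewrite -addnA -leq_subRL -?size_drop//.
  by rewrite ss mulSn leq_addr.
by rewrite drop_drop in h; rewrite addnC.
Qed.

End blocks.
End pair_chain.

(** * Measures of events on finite windows *)

Lemma borel_cantelli_geometric d (T : measurableType d) (R : realType)
    (nu : {measure set T -> \bar R}) (F : nat -> set T) (a z : R) :
  (forall n, measurable (F n)) -> 0 <= a -> 0 < z -> z < 1 ->
  (forall n, (nu (F n) <= (a * z ^+ n)%:E)%E) ->
  {ae nu, forall x, \forall n \near \oo, ~ F n x}.
Proof.
move=> mF a0 z0 z1 Fz; exists (lim_sup_set F); split.
- apply: bigcap_measurable => // n _.
  by apply: bigcup_measurable => k _; exact: mF.
- apply: lim_sup_set_cvg0 => //.
  apply: (@le_lt_trans _ _ (a * (1 - z)^-1)%:E); last exact: ltry.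
  apply: lime_le; first exact: is_cvg_nneseries.
  apply: nearW => n.
  apply: (@le_trans _ _ (\sum_(0 <= i < n) (a * z ^+ i)%:E)%E).
    exact: lee_sum.
  rewrite sumEFin lee_fin; apply: geometric_le_lim => //.
  by rewrite ger0_norm// ltW.
- move=> x /= nF n _; apply: contrapT => noF; apply: nF.
  by exists n => // k nk Fk; apply: noF; exists k.
Qed.

Section pair_paths.
Context {R : realType} {V : finType} {v0 : V}.
Variables (P : V -> V -> R) (pi : V -> R) (mu : probability (path_space v0) R).
Notation T := (path_space v0).
Implicit Types (u s : seq (V * V)) (F : seq (V * V) -> bool).

(** Times start at 0 here, whereas [word] counts from 1. Pairing the letters turns agreement into
    staying on the diagonal. *)
Definition window (xy : T * T) i n : seq (V * V) :=
  [seq (xy.1 j, xy.2 j) | j <- iota i n].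

Lemma size_window xy i n : size (window xy i n) = n.
Proof. by rewrite size_map size_iota. Qed.

Lemma window_cat xy i n m :
  window xy i (n + m) = window xy i n ++ window xy (i + n) m.
Proof. by rewrite /window iotaD map_cat. Qed.

Lemma window_rcons xy i n :
  window xy i n.+1 = rcons (window xy i n) (xy.1 (i + n)%N, xy.2 (i + n)%N).
Proof. by rewrite -addn1 window_cat /= cats1. Qed.

Lemma window_drop xy n m : drop n (window xy 0 (n + m)) = window xy n m.
Proof. by rewrite window_cat drop_size_cat ?size_window. Qed.

Lemma word1E (x : T) n : word x 1 n = [seq x j | j <- iota 0 n].
Proof.
by rewrite /word subSS subn0 (iotaDl 1 0) -map_comp.
Qed.

Lemma window_setE u : [set xy | window xy 0 (size u) = u] =
  cylinder (v0 := v0) (map fst u) `*` cylinder (v0 := v0) (map snd u).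
Proof.
apply/seteqP; split => [[x y]|[x y]] /=; rewrite /cylinder /= !word1E !size_map.
  by move=> h; split; rewrite -[in RHS]h /window -map_comp.
case=> xu yu; rewrite /window.
elim: u 0%N xu yu => [//|[a b] u IH] i /= [xi xu] [yi yu].
by rewrite xi yi IH.
Qed.

Lemma measurable_cylinder (u : seq V) : measurable (cylinder (v0 := v0) u).
Proof. by apply: sub_gen_smallest; exists u. Qed.

Lemma measurable_window_eq u : measurable [set xy | window xy 0 (size u) = u].
Proof.
by rewrite window_setE; apply: measurableX; exact: measurable_cylinder.
Qed.

(** There are only countably many finite words, and each of them defines a product of two
    cylinders. *)
Lemma measurable_window n F : measurable [set xy | F (window xy 0 n)].
Proof.
have -> : [set xy | F (window xy 0 n)] = \bigcup_(u : seq (V * V))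
    if (size u == n) && F u then [set xy | window xy 0 (size u) = u] else set0.
  apply/seteqP; split => [xy /= h|xy [u _]].
    by exists (window xy 0 n) => //; rewrite size_window eqxx h.
  by case: ifPn => //= /andP[/eqP <- Fu] ->.
apply: countable_bigcupT_measurable => [|u]; first exact: countableP.
by case: ifP => _; [exact: measurable_window_eq|exact: measurable0].
Qed.

Lemma measurable_window_at i n F : measurable [set xy | F (window xy i n)].
Proof.
have -> : [set xy | F (window xy i n)] =
    [set xy | F (drop i (window xy 0 (i + n)))].
  by apply/seteqP; split => xy /=; rewrite window_drop.
exact: (measurable_window _ (fun s => F (drop i s))).
Qed.

Hypothesis Hmu : markov_measure P pi mu.
Notation nu := (mu \x mu)%E.

Definition word_prob (u : seq V) : R := pi (nth v0 u 0) *
  \prod_(0 <= j < (size u).-1) P (nth v0 u j) (nth v0 u j.+1).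

Lemma word_prob_rcons (a : V) (u : seq V) b :
  word_prob (rcons (a :: u) b) = word_prob (a :: u) * P (last a u) b.
Proof.
rewrite /word_prob size_rcons /= big_nat_recr//= mulrA; congr (_ * _ * _).
  rewrite big_nat_cond [RHS]big_nat_cond; apply: eq_bigr => j.
  rewrite andbT => /andP[_ ju].
  rewrite -!rcons_cons nth_rcons/= ltnS (ltnW ju); congr P.
  by rewrite nth_rcons ju.
rewrite -rcons_cons nth_rcons/= ltnS leqnn nth_rcons ltnn eqxx.
by rewrite (last_nth v0).
Qed.

(** This links the product measure to [path_exp]: after a fixed nonempty prefix, the next [n] pairs
    follow the pair chain from its last pair. The induction on [n] lets the prefix vary. *)
Lemma window_measure a u n F :
  nu [set xy | window xy 0 (size u).+1 = a :: u /\
               F (window xy (size u).+1 n)] =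
  (word_prob (map fst (a :: u)) * word_prob (map snd (a :: u)) *
   path_exp (pair_kernel P) n (fun s => (F s)%:R) (last a u))%:E.
Proof.
elim: n u F => [|n IH] u F.
  have -> : [set xy | window xy 0 (size u).+1 = a :: u /\
               F (window xy (size u).+1 0)] =
      [set xy | window xy 0 (size (a :: u)) = a :: u] `&` [set xy | F [::]].
    by [].
  rewrite [path_exp _ 0 _ _]/=; case: (F [::]); last first.
    by rewrite (_ : [set _ : T * T | false] = set0) ?setI0 ?measure0 ?mulr0//;
      apply/seteqP; split.
  rewrite (_ : [set _ : T * T | true] = setT) ?setIT; last first.
    by apply/seteqP; split.
  rewrite mulr1 window_setE product_measure1E; try exact: measurable_cylinder.
  by rewrite EFinM; congr (_ * _)%E; exact: Hmu.
(* Partition by the next pair [b], which is moved from the future into the prefix. *)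
have -> : [set xy | window xy 0 (size u).+1 = a :: u /\
               F (window xy (size u).+1 n.+1)] =
    \bigcup_(b in [set` index_enum (V * V)%type]) [set xy |
      window xy 0 (size (rcons u b)).+1 = a :: rcons u b /\
      F (b :: window xy (size (rcons u b)).+1 n)].
  apply/seteqP; split => xy /=.
    move=> [xyu Fxy]; exists (xy.1 (size u).+1, xy.2 (size u).+1).
      by rewrite /= mem_index_enum.
    by rewrite /= size_rcons window_rcons xyu.
  move=> [b _] /=; rewrite size_rcons window_rcons => -[h Fb].
  have /eqP := h; rewrite -rcons_cons eqseq_rcons => /andP[/eqP h1 /eqP h2].
  by split; [exact: h1|rewrite -h2 in Fb; exact: Fb].
rewrite measure_fin_bigcup//; first last.
- move=> b _; exact: (measurableI _ _ (measurable_window_eq (a :: rcons u b))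
    (measurable_window_at _ _ (fun s => F (b :: s)))).
- move=> b c _ _ [xy [[+ _] [+ _]]].
  by rewrite !size_rcons => -> [] /rcons_inj[].
rewrite -fsbig_seq ?index_enum_uniq//=.
rewrite mulr_sumr -sumEFin; apply: eq_bigr => b _.
rewrite (IH (rcons u b) (fun s => F (b :: s))); congr EFin.
rewrite !map_cons !map_rcons -!rcons_cons !word_prob_rcons !last_map last_rcons.
by rewrite mulrACA -[LHS]mulrA.
Qed.

Lemma prefix_measure n F :
  nu [set xy | F (window xy 0 n.+1)] =
  (\sum_a pi a.1 * pi a.2 *
    path_exp (pair_kernel P) n (fun s => (F (a :: s))%:R) a)%:E.
Proof.
have -> : [set xy | F (window xy 0 n.+1)] =
    \bigcup_(a in [set` index_enum (V * V)%type]) [set xy |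
      window xy 0 (size (nil : seq (V * V))).+1 = [:: a] /\
      F (a :: window xy (size (nil : seq (V * V))).+1 n)].
  apply/seteqP; split => xy /=.
    by move=> h; exists (xy.1 0%N, xy.2 0%N) => //=; rewrite mem_index_enum.
  by case=> a _ [[<-]].
rewrite measure_fin_bigcup//; first last.
- move=> a _; exact: (measurableI _ _ (measurable_window_eq [:: a])
    (measurable_window_at _ _ (fun s => F (a :: s)))).
- by move=> a b _ _ [xy [[+ _] [+ _]]] => -> [].
rewrite -fsbig_seq ?index_enum_uniq//=.
rewrite -sumEFin; apply: eq_bigr => a _.
rewrite (window_measure a [::] n (fun s => F (a :: s))) /word_prob/=.
by rewrite !big_nil !mulr1.
Qed.

End pair_paths.

(** * The Perron eigenvalue of the matrix of squared transition probabilities *)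

Lemma exp_mx_ge0 (R : realType) n (A : 'M[R]_n) k :
  (forall i j, 0 <= A i j) -> forall i j, 0 <= (A ^+ k) i j.
Proof.
move=> A0; elim: k => [|k IH] i j; first by rewrite expr0 mxE ler0n.
have -> : A ^+ k.+1 = A *m A ^+ k by exact: exprS.
exact: mulmx_ge0.
Qed.

(** A positive entry of a power comes from a path of positive entries, so only the support matters.
    This carries mixing over from [P] to its entrywise square. *)
Lemma exp_mx_gt0_support (R : realType) n (A B : 'M[R]_n) k :
  (forall i j, 0 <= A i j) -> (forall i j, 0 <= B i j) ->
  (forall i j, 0 < A i j -> 0 < B i j) ->
  forall i j, 0 < (A ^+ k) i j -> 0 < (B ^+ k) i j.
Proof.
move=> A0 B0 AB; elim: k => [//|k IH] i j.
have -> : A ^+ k.+1 = A *m A ^+ k by exact: exprS.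
have -> : B ^+ k.+1 = B *m B ^+ k by exact: exprS.
rewrite !mxE => sA.
have /existsP[m] : [exists m, 0 < A i m * (A ^+ k) m j].
  apply: contraTT sA => /existsPn h; rewrite -leNgt.
  by apply: sumr_le0 => m _; rewrite leNgt.
rewrite lt0r mulf_eq0 negb_or => /andP[/andP[Aim Akm] _].
apply: sumr_gt0_exists => [m'|]; first by rewrite mulr_ge0// exp_mx_ge0.
exists m; rewrite mulr_gt0//; [apply: AB|apply: IH].
  by rewrite lt_def Aim A0.
by rewrite lt_def Akm exp_mx_ge0.
Qed.

Lemma stochastic_le1 (R : realType) (V : finType) (P : V -> V -> R) u v :
  stochastic P -> P u v <= 1.
Proof.
by case=> P0 P1; rewrite -(P1 u) ler_sum_term.
Qed.

Lemma chainL_perron (R : realType) (V : finType) (v0 : V) (P : V -> V -> R) :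
  stochastic P -> mixing P ->
  exists (lam : R) (l : V -> R), [/\ 0 < lam <= 1, forall v, 0 < l v,
    \sum_v l v = 1, forall w, \sum_v l v * P v w ^+ 2 = lam * l w &
    chainL P = - ln lam].
Proof.
move=> Pst [k k1 Pk]; have [P0 P1] := Pst.
have n0 : (0 < #|V|)%N by apply/card_gt0P; exists v0.
pose Q := matrix_of (fun u v => P u v ^+ 2).
have Q0 i j : 0 <= Q i j by rewrite mxE sqr_ge0.
have Qk i j : 0 < (Q ^+ k) i j.
  apply: (@exp_mx_gt0_support _ _ (matrix_of P)) => // i' j'.
    by rewrite mxE.
  by rewrite !mxE => Pij; rewrite exprn_gt0.
have [lam [l [lam0 l0 l1 lQ rho]]] := spectral_radius_perron Q0 n0 k1 Qk.
have lP w : \sum_v l 0 (enum_rank v) * P v w ^+ 2 = lam * l 0 (enum_rank w).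
  have := lQ => /rowP/(_ (enum_rank w)); rewrite !mxE => <-.
  rewrite sum_enum_rank; apply: eq_bigr => v _.
  by rewrite mxE !enum_rankK.
have l1' : \sum_v l 0 (enum_rank v) = 1 by rewrite -sum_enum_rank.
exists lam, (fun v => l 0 (enum_rank v)); split => //; last first.
  by rewrite /chainL rho.
(* [lam] is the total mass of [l Q], and the row sums of Q are at most those of [P], which are 1. *)
rewrite lam0/= -[leLHS]mulr1 -{1}l1' mulr_sumr.
under eq_bigr do rewrite -lP.
rewrite exchange_big/= -l1'; apply: ler_sum => v _.
rewrite -mulr_sumr ger_pMr// -(P1 v); apply: ler_sum => w _.
by rewrite expr2 ler_piMr ?stochastic_le1.
Qed.

(** * Matching probabilities *)

Section matching_bounds.
Context {R : realType} {V : finType} {v0 : V}.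
Variables (P : V -> V -> R) (pi : V -> R) (mu : probability (path_space v0) R).
Hypothesis Pst : stochastic P.
Hypothesis Pmix : mixing P.
Hypothesis pist : stationary P pi.
Hypothesis Hmu : markov_measure P pi mu.
Variables (lam : R) (l : V -> R).
Hypothesis lam01 : 0 < lam <= 1.
Hypothesis l0 : forall v, 0 < l v.
Hypothesis l1 : \sum_v l v = 1.
Hypothesis lP : forall w, \sum_v l v * P v w ^+ 2 = lam * l w.
Notation T := (path_space v0).
Notation nu := (mu \x mu)%E.

Let pi0 v : 0 <= pi v. Proof. by case: pist. Qed.

Let pi_le1 v : pi v <= 1.
Proof.
by case: pist => _ <- _; rewrite ler_sum_term.
Qed.

Let l_le1 v : l v <= 1.
Proof.
by rewrite -l1 ler_sum_term// => w; rewrite ltW.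
Qed.

Let pi2_stationary b :
  \sum_a pi a.1 * pi a.2 * pair_kernel P a b = pi b.1 * pi b.2.
Proof.
case: pist => _ _ piP; rewrite sum_pair -!piP mulr_suml.
apply: eq_bigr => u _; rewrite mulr_sumr; apply: eq_bigr => v _.
by rewrite /pair_kernel/= mulrACA.
Qed.

Let pi2_sum : \sum_a pi a.1 * pi a.2 = 1.
Proof.
case: pist => _ pi1 _; rewrite sum_pair -[RHS]pi1; apply: eq_bigr => u _.
by rewrite /= -mulr_sumr pi1 mulr1.
Qed.

(** Stationarity moves the window to time 0, leaving the sum of [pi v ^+ 2 * diag_prob P n (v, v)].
    With [m] the lower bound of [l], [pi v ^+ 2 <= 1 <= l v / m], and the eigenvector sum
    applies. *)
Lemma match_measure : exists2 C, 0 < C & forall t n,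
  (nu [set xy : T * T | all diag (window xy t n.+1)] <= (C * lam ^+ n)%:E)%E.
Proof.
have [m m0 ml] := fin_pos_lower_bound v0 l0.
exists m^-1; first by rewrite invr_gt0.
move=> t n.
have -> : [set xy : T * T | all diag (window xy t n.+1)] =
    [set xy : T * T | all diag (drop t (window xy 0 (t + n).+1))].
  by rewrite -addnS; apply/seteqP; split => xy; rewrite /mkset window_drop.
rewrite (prefix_measure Hmu (t + n) (fun s => all diag (drop t s))) lee_fin.
rewrite (path_exp_stationary _ _ (fun s => (all diag s)%:R))//.
have -> : \sum_a pi a.1 * pi a.2 *
      path_exp (pair_kernel P) n (fun s => (all diag (a :: s))%:R) a =
    \sum_v pi v ^+ 2 * diag_prob P n (v, v).
  rewrite -[RHS](sum_diag (fun a => pi a.1 * pi a.2 * diag_prob P n a)).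
  apply: eq_bigr => a _; rewrite mulrCA; congr (_ * _).
  rewrite -path_expZ; apply: eq_path_exp => s _ /=.
  by rewrite -natrM mulnb.
rewrite -(sum_diag_prob n l1 lP) mulr_sumr; apply: ler_sum => v _.
rewrite mulrA ler_wpM2r ?diag_prob_ge0//.
apply: (@le_trans _ _ 1); first by rewrite exprn_ile1.
by rewrite ler_pdivlMl// mulr1.
Qed.

Lemma early_match_measure : exists2 C, 0 < C & forall N n,
  (nu (\big[setU/set0]_(t < N) [set xy : T * T | all diag (window xy t n.+1)])
    <= (N%:R * (C * lam ^+ n))%:E)%E.
Proof.
have [C C0 hC] := match_measure; exists C => // N n.
pose F t := [set xy : T * T | all diag (window xy t n.+1)].
apply: (@le_trans _ _ (\sum_(t < N) nu (F t))%E).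
  apply: (@le_mu_bigsetU _ _ _ nu F) => t _.
  exact: (measurable_window_at _ _ (all diag)).
apply: (@le_trans _ _ (\sum_(t < N) (C * lam ^+ n)%:E)%E).
  by apply: lee_sum => t _; exact: hC.
by rewrite sumEFin sumr_const card_ord mulr_natl.
Qed.

Lemma no_match_measure : exists k delta, [/\ 0 < delta, delta <= 1 &
  forall m n, (nu [set xy : T * T |
      no_match k (k.+1 + n) m (window xy 1 (m * (k.+1 + n)))] <=
    ((1 - delta * lam ^+ n) ^+ m)%:E)%E].
Proof.
case: Pmix => -[//|k] _ Pk.
have [d d0 dP] := @fin_pos_lower_bound R ('I_#|V| * 'I_#|V|)%type
  (enum_rank v0, enum_rank v0) (fun ij => (matrix_of P ^+ k.+1) ij.1 ij.2)
  (fun ij => Pk ij.1 ij.2).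
(* Capping at 1 makes the success probability [q = e ^+ 2 * lam ^+ n] at most 1, as [no_match_prob]
   requires. *)
pose e := Num.min d 1.
have e0 : 0 < e by rewrite lt_min d0 ltr01.
have e1 : e <= 1 by rewrite ge_min lexx orbT.
exists k, (e ^+ 2); split; [exact: exprn_gt0|by rewrite exprn_ile1// ltW|].
move=> m n; case/andP: lam01 => lam0 lam1.
have q1 : e ^+ 2 * lam ^+ n <= 1.
  by rewrite mulr_ile1 ?exprn_ge0 ?exprn_ile1// ltW.
have block a : e ^+ 2 * lam ^+ n <= path_exp (pair_kernel P) (k.+1 + n)
    (fun s => (all diag (drop k s))%:R) a.
  apply: le_trans (block_match_prob Pst n a _ (ltW e0)); last first.
    move=> i j; apply: (le_trans _ (dP (i, j))).
    by rewrite ge_min lexx.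
  (* Since [l v <= 1], the unweighted sum dominates the weighted one, which is [lam ^+ n]. *)
  rewrite ler_wpM2l ?exprn_ge0 ?(ltW e0)// -(sum_diag_prob n l1 lP).
  apply: ler_sum => v _.
  by rewrite ler_piMl// ?diag_prob_ge0.
(* The blocks begin at time 1: the pair at time 0 is the starting state of [path_exp]. *)
have -> : [set xy : T * T |
      no_match k (k.+1 + n) m (window xy 1 (m * (k.+1 + n)))] =
    [set xy : T * T |
      no_match k (k.+1 + n) m (drop 1 (window xy 0 (m * (k.+1 + n)).+1))].
  by rewrite -add1n; apply/seteqP; split => xy; rewrite /mkset window_drop.
rewrite (prefix_measure Hmu _ (fun s => no_match k (k.+1 + n) m (drop 1 s))).
rewrite lee_fin -[leRHS]mul1r -[X in _ <= X * _]pi2_sum mulr_suml.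
apply: ler_sum => a _.
rewrite ler_wpM2l ?mulr_ge0//.
rewrite (@eq_path_exp _ _ _ _ _ (fun s => (no_match k (k.+1 + n) m s)%:R)).
  exact: (no_match_prob Pst m a q1 block).
by move=> s _; rewrite /= drop0.
Qed.

End matching_bounds.

(** * Words as windows, and a subexponential factor *)

Lemma word_window (V : finType) (v0 : V) (xy : path_space v0 * path_space v0)
    t n :
  word xy.1 t.+1 (t.+1 + n.+1 - 1) = word xy.2 t.+1 (t.+1 + n.+1 - 1) <->
  all diag (window xy t n.+1).
Proof.
have wE (x : path_space v0) :
    word x t.+1 (t.+1 + n.+1 - 1) = [seq x j | j <- iota t n.+1].
  rewrite /word addnS subn1 -pred_Sn -addnS addKn (iotaDl 1 t) -map_comp.
  by [].
rewrite !wE -eq_in_map /window all_map; split => [h|/allP h].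
  by apply/allP => j /h /= xyj; rewrite /diag/= xyj.
by move=> j /h /eqP.
Qed.

Lemma window_sub (V : finType) (v0 : V) (xy : path_space v0 * path_space v0)
    i t n N : (t + n <= N)%N ->
  take n (drop t (window xy i N)) = window xy (i + t) n.
Proof.
move=> /subnKC <-; rewrite -addnA !window_cat drop_size_cat ?size_window//.
by rewrite take_size_cat ?size_window.
Qed.

Lemma ln_linear_le (R : realType) (k : nat) (eps : R) : 0 < eps ->
  \forall n \near \oo, ln (2 * (k.+2 + n)%:R) <= n.+1%:R * eps :> R.
Proof.
move=> e0.
(* With [x = n.+1] and [y = x * eps / 2], the exponential is at least [(1 + y)^2 >= y^2], and this
   threshold makes [y^2] exceed [2 * k.+2 * x]. *)
apply: filterS (nbhs_infty_ger (8 * k.+2%:R / eps ^+ 2)) => n xn.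
rewrite -ler_expR lnK; last by rewrite posrE mulr_gt0// ltr0n.
set x : R := n.+1%:R.
have x1 : 1 <= x by rewrite ler1n.
have xk : 8 * k.+2%:R / eps ^+ 2 <= x by apply: le_trans xn _; rewrite ler_nat.
have kn : (k.+2 + n)%:R <= k.+2%:R * x.
  by rewrite -natrM ler_nat; nia.
have -> : x * eps = 2%:R * (x * eps / 2) by field.
rewrite expRM_natl; have h := expR_ge1Dx (x * eps / 2).
have y0 : 0 <= x * eps / 2 by rewrite divr_ge0// mulr_ge0// ltW.
apply: (@le_trans _ _ ((x * eps / 2) ^+ 2)); last first.
  by rewrite lerXn2r ?nnegrE ?expR_ge0//; apply: le_trans h; rewrite lerDr.
rewrite ler_pdivrMr ?exprn_gt0// in xk.
apply: (@le_trans _ _ (2 * (k.+2%:R * x))); first by rewrite ler_pM2l.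
have -> : (x * eps / 2) ^+ 2 = x * (x * eps ^+ 2) / 4 by field.
have := ler_wpM2l (le_trans ler01 x1) xk.
set K : R := k.+2%:R; set w := x * (x * eps ^+ 2); move=> hw.
by rewrite ler_pdivlMr//; nra.
Qed.

(** * Almost sure bounds on the matching time *)

Section almost_sure_bounds.
Context {R : realType} {V : finType} {v0 : V}.
Variables (P : V -> V -> R) (pi : V -> R) (mu : probability (path_space v0) R).
Hypothesis Pst : stochastic P.
Hypothesis Pmix : mixing P.
Hypothesis pist : stationary P pi.
Hypothesis Hmu : markov_measure P pi mu.
Variables (lam : R) (l : V -> R).
Hypothesis lam01 : 0 < lam <= 1.
Hypothesis l0 : forall v, 0 < l v.
Hypothesis l1 : \sum_v l v = 1.
Hypothesis lP : forall w, \sum_v l v * P v w ^+ 2 = lam * l w.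
Notation T := (path_space v0).
Notation nu := (mu \x mu)%E.

(** Here [z] stands for [expR (- eps)]. The union bound over [(z / lam) ^+ n.+1] starting times
    costs a constant times [z ^+ n], which is summable. *)
Lemma early_match_ae (z : R) : 0 < z < 1 ->
  {ae nu, forall xy : T * T, \forall n \near \oo, forall t,
    all diag (window xy t n.+1) -> (z / lam) ^+ n.+1 <= t.+1%:R}.
Proof.
case/andP: (lam01) => lam0 _ /andP[z0 z1].
have [C C0 hC] := early_match_measure Pst pist Hmu l0 l1 lP.
pose N n := Num.truncn ((z / lam) ^+ n.+1).
pose F n := \big[setU/set0]_(t < N n)
  [set xy : T * T | all diag (window xy t n.+1)].
have mF n : measurable (F n).
  apply: bigsetU_measurable => t _.
  exact: (measurable_window_at _ _ (all diag)).
have FC n : (nu (F n) <= (C * z / lam * z ^+ n)%:E)%E.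
  apply: (le_trans (hC _ _)); rewrite lee_fin.
  apply: (@le_trans _ _ ((z / lam) ^+ n.+1 * (C * lam ^+ n))).
    rewrite ler_wpM2r ?mulr_ge0 ?exprn_ge0 ?(ltW lam0) ?(ltW C0)//.
    by rewrite truncn_le exprn_ge0// divr_ge0// ltW.
  rewrite expr_div_n !exprS le_eqVlt; apply/orP; left; apply/eqP.
  by field; rewrite expf_neq0 gt_eqF.
have a0 : 0 <= C * z / lam by rewrite divr_ge0 ?mulr_ge0// ltW.
have := @borel_cantelli_geometric _ _ _ nu F _ _ mF a0 z0 z1 FC.
apply: filterS => xy; apply: filterS => n nF t tm.
rewrite leNgt; apply/negP => /ltW; rewrite -truncn_gt_nat => tN; apply: nF.
rewrite /F -(bigcup_mkord _ (fun t =>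
  [set xy : T * T | all diag (window xy t n.+1)])).
by exists t.
Qed.

(** About [(z * lam)^-1 ^+ n.+1] blocks are tried, each succeeding with probability at least
    [d * lam ^+ n]. The gap [k] does not depend on [z]. *)
Lemma late_match_ae : exists k, forall z : R, 0 < z < 1 ->
  {ae nu, forall xy : T * T, \forall n \near \oo, exists t,
    all diag (window xy t n.+1) /\
    t.+1%:R <= 2 * (k.+2 + n)%:R * ((z * lam)^-1) ^+ n.+1}.
Proof.
have [k [d [d0 d1 hk]]] := no_match_measure Pst Pmix pist Hmu lam01 l0 l1 lP.
case/andP: (lam01) => lam0 lam1.
exists k => z /andP[z0 z1].
pose x n := (z * lam)^-1 ^+ n.+1.
have x1 n : 1 <= x n.
  by rewrite exprn_ege1// invf_ge1 ?mulr_gt0// mulr_ile1// ltW.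
pose m n := (Num.truncn (x n)).+1.
pose F n := [set xy : T * T |
  no_match k (k.+1 + n) (m n) (window xy 1 (m n * (k.+1 + n)))].
have mF n : measurable (F n).
  exact: (measurable_window_at _ _ (no_match k (k.+1 + n) (m n))).
have FC n : (nu (F n) <= (lam * z / d * z ^+ n)%:E)%E.
  apply: (le_trans (hk _ _)); rewrite lee_fin.
  set q := d * lam ^+ n.
  have q0 : 0 < q by rewrite mulr_gt0// exprn_gt0.
  have q1 : q <= 1 by rewrite mulr_ile1 ?exprn_ge0 ?exprn_ile1// ltW.
  have m0 : 0 < (m n)%:R :> R by rewrite ltr0n.
  have x0 : 0 < x n by exact: lt_le_trans ltr01 (x1 n).
  have mq0 : 0 < (m n)%:R * q by exact: mulr_gt0.
  have xq0 : 0 < x n * q by exact: mulr_gt0.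
  (* The chain is [(1 - q)^m <= exp(-m q) <= 1 / (m q) <= 1 / (x q)], and the last term equals
     [lam * z / d * z ^+ n]. *)
  apply: (@le_trans _ _ (expR (- q) ^+ m n)).
    rewrite lerXn2r ?nnegrE ?expR_ge0 ?subr_ge0//.
    exact: expR_ge1Dx.
  rewrite -expRM_natl mulrN expRN.
  apply: (@le_trans _ _ (((m n)%:R * q)^-1)).
    rewrite lef_pV2 ?posrE ?expR_gt0//.
    by apply: le_trans (expR_ge1Dx _); rewrite lerDr.
  apply: (@le_trans _ _ ((x n * q)^-1)).
    rewrite lef_pV2 ?posrE//.
    by rewrite ler_pM2r// ltW// truncnS_gt.
  rewrite /x /q exprVn exprMn !exprS le_eqVlt; apply/orP; left; apply/eqP.
  by field; rewrite !expf_neq0 ?gt_eqF.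
have a0 : 0 <= lam * z / d by rewrite divr_ge0 ?mulr_ge0// ltW.
have := @borel_cantelli_geometric _ _ _ nu F _ _ mF a0 z0 z1 FC.
apply: filterS => xy; apply: filterS => n /negP nF.
have [t tN tm] := no_matchPn (size_window _ _ _) nF.
rewrite size_window in tN; rewrite window_sub// in tm.
exists (1 + t)%N; split=> //.
(* Using [k.+2] instead of [k.+1] absorbs the shift caused by starting the blocks at time 1. *)
have tle : ((1 + t).+1 <= m n * (k.+2 + n))%N.
  by move: tN; rewrite /m; nia.
apply: (@le_trans _ _ ((m n * (k.+2 + n))%:R)); first by rewrite ler_nat.
rewrite natrM mulrAC ler_wpM2r//.
(* The number of blocks is at most [x n + 1 <= 2 * x n], because [x n >= 1]. *)
rewrite /m -addn1 natrD mulr_natl mulr2n lerD ?x1//.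
by rewrite truncn_le (le_trans ler01).
Qed.

End almost_sure_bounds.

(** * From matching bounds to the limit of the logarithm *)

Lemma matching_time_bounds (R : realType) (V : finType) (v0 : V)
    (xy : path_space v0 * path_space v0) n t (a b : R) :
  (forall t, all diag (window xy t n.+1) -> a <= t.+1%:R) ->
  all diag (window xy t n.+1) -> t.+1%:R <= b ->
  exists2 r, matching_time R n.+1 xy.1 xy.2 = r%:E & a <= r <= b.
Proof.
move=> ha ht tb; set M := matching_time _ _ _ _.
have aM : (a%:E <= M)%E.
  apply: le_ereal_inf_tmp => _ [[|s] [//= _ /word_window sm] <-].
  by rewrite lee_fin; exact: ha.
have Mb : (M <= b%:E)%E.
  apply: (@le_trans _ _ (t.+1%:R)%:E); last by rewrite lee_fin.
  by apply: ereal_inf_lbound; exists t.+1 => //; split => //; apply/word_window.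
have Mfin : M \is a fin_num.
  rewrite fin_numE -ltNye -ltey (lt_le_trans (ltNyr a) aM).
  exact: le_lt_trans Mb (ltry b).
by exists (fine M); rewrite ?fineK// -!lee_fin fineK// aM.
Qed.

(** After taking logarithms and dividing by [n.+1], the lower bound loses [eps]; the upper bound
    loses [eps] from the exponential and another from the factor [2 * (k.+2 + n)]. *)
Lemma lne_matching_time_bounds (R : realType) (V : finType) (v0 : V)
    (xy : path_space v0 * path_space v0) n k t (lam eps : R) :
  0 < lam -> ln (2 * (k.+2 + n)%:R) <= n.+1%:R * eps ->
  (forall t, all diag (window xy t n.+1) ->
     (expR (- eps) / lam) ^+ n.+1 <= t.+1%:R) ->
  all diag (window xy t n.+1) ->
  t.+1%:R <= 2 * (k.+2 + n)%:R * ((expR (- eps) * lam)^-1) ^+ n.+1 ->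
  exists2 r, lne (matching_time R n.+1 xy.1 xy.2) = r%:E &
    `|- ln lam - n.+1%:R^-1 * r| <= 2 * eps.
Proof.
move=> lam0 lnk early tm late.
have [r -> /andP[ar rb]] := matching_time_bounds early tm late.
have z0 : 0 < expR (- eps) by exact: expR_gt0.
have a0 : 0 < (expR (- eps) / lam) ^+ n.+1 by rewrite exprn_gt0// divr_gt0.
have r0 : 0 < r by exact: lt_le_trans a0 ar.
have b0 : 0 < 2 * (k.+2 + n)%:R :> R by rewrite mulr_gt0// ltr0n.
have c0 : 0 < (expR (- eps) * lam)^-1 by rewrite invr_gt0 mulr_gt0.
exists (ln r); first by rewrite lne_EFin.
move: ar; rewrite -ler_ln ?posrE// lnXn ?divr_gt0// ln_div ?posrE// expRK => ar.
move: rb; rewrite -ler_ln ?posrE ?mulr_gt0 ?exprn_gt0//.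
rewrite lnM ?posrE ?exprn_gt0// lnXn// lnV ?posrE ?mulr_gt0// lnM ?posrE//.
rewrite expRK => rb.
have x0 : 0 < n.+1%:R :> R by rewrite ltr0n.
rewrite -(ler_pM2l x0) -[X in X * _]gtr0_norm// -normrM mulrBr mulVKf ?gt_eqF//.
rewrite -[_ *+ n.+1]mulr_natl in ar; rewrite -[_ *+ n.+1]mulr_natl in rb.
by rewrite ler_norml; apply/andP; split; lra.
Qed.

Theorem theorem1p4 (R : realType) (V : finType) (v0 : V)
    (P : V -> V -> R) (pi : V -> R) (mu : probability (path_space v0) R) :
  stochastic P -> mixing P -> stationary P pi -> markov_measure P pi mu ->
  {ae (mu \x mu)%E, forall xy : path_space v0 * path_space v0,
    ((n%:R^-1)%:E * lne (matching_time R n xy.1 xy.2))%E @[n --> \oo] -->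
      (chainL P)%:E}.
Proof.
move=> Pst Pmix pist Hmu.
have [lam [l [lam01 l0 l1 lP ->]]] := chainL_perron v0 Pst Pmix.
have [k hk] := late_match_ae Pst Pmix pist Hmu lam01 l0 l1 lP.
pose close (xy : path_space v0 * path_space v0) (eps : R) :=
  \forall n \near \oo,
  exists2 r, lne (matching_time R n.+1 xy.1 xy.2) = r%:E &
    `|- ln lam - n.+1%:R^-1 * r| <= 2 * eps.
have ae_close p : {ae (mu \x mu)%E, forall xy : path_space v0 * path_space v0,
    close xy p.+1%:R^-1}.
  set eps : R := p.+1%:R^-1.
  have eps0 : 0 < eps by rewrite invr_gt0 ltr0n.
  have z01 : 0 < expR (- eps) < 1 by rewrite expR_gt0 expR_lt1 oppr_lt0.
  have early := early_match_ae Pst pist Hmu lam01 l0 l1 lP z01.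
  apply: filterS2 early (hk _ z01) => xy early late.
  apply: filterS3 early late (ln_linear_le k eps0).
  move=> n early [t [tm late]] lnk.
  by apply: lne_matching_time_bounds lnk early tm late; case/andP: lam01.
(* Countably many null sets are discarded, so one set of full measure serves every [p]. *)
apply: filterS (ae_foralln ae_close) => xy xyclose.
apply/fine_cvgP; split.
  (* The estimates concern words of length [n.+1], hence the shift of the index; they also give
     eventual finiteness. *)
  apply: near_inftyS; apply: filterS (xyclose 0%N) => n [r -> _].
  by rewrite -EFinM.
apply/cvgrPdist_le => eps eps0.
have [p pe] : exists p, 2 * p.+1%:R^-1 <= eps.
  exists (Num.truncn (2 / eps)); rewrite ler_pdivrMr ?ltr0n// mulrC.
  by rewrite -ler_pdivrMr// ltW// truncnS_gt.
apply: near_inftyS; apply: filterS (xyclose p) => n [r rE rp].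
by rewrite /= rE -EFinM /=; exact: le_trans rp pe.
Qed.
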